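(* Let $\lambda,\omega\in(0,1)$ be such that $(1-\lambda)/\lambda$ is an integer multiple of $\omega$, let $R<C(\lambda,\omega)=1-\lambda-\omega+\lambda\omega^2$, and let $\pi>0$. Then (for all sufficiently large $N$) there exists an error correcting code of rate at least $R$ for the channel $\mathrm{SNC}(\lambda,\omega)$ together with a decoding algorithm that achieves symbol error probability smaller than $\pi$, with decoding complexity $O(N^4\log\log(1/\pi))$ operations.
   Context: Fix a prime power $q$. For an integer $N$ let $\ell=\lambda N$ and $m=N-\ell$. The symmetric network coding channel $\mathrm{SNC}(\lambda,\omega)$ takes as input an $\ell\times m$ matrix $\underline{x}$ over $\mathbb{F}_q$ and outputs $\underline{y}=\underline{x}+\underline{z}$, where $\underline{z}$ is uniformly random, independent of $\underline{x}$, among all $\ell\times m$ matrices over $\mathbb{F}_q$ of rank $\ell\omega$. A code $\mathfrak{C}$ is a set of $\ell\times m$ matrices over $\mathbb{F}_q$ (each row is a packet of length $N$ once an $\ell\times\ell$ identity header is prepended); its rate is $R(\mathfrak{C})=\log_q|\mathfrak{C}|/(N\ell)$. The symbol error probability is the probability that a row of the transmitted matrix is decoded incorrectly (per row of $\underline{x}$). Complexity is measured in operations over $\mathbb{F}_q$. *)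

(* Defs.v *)
From Stdlib Require Import Reals.
From mathcomp Require Import all_boot all_order all_algebra all_field.
Set Implicit Arguments. Unset Strict Implicit. Unset Printing Implicit Defensive.
Import GRing.Theory.

(* ---------- Cost model: straight-line programs over a field F ----------
   A program is a list of instructions; instruction number t produces the
   value v_t.  Each instruction is one operation over F.  Out-of-range
   references default to 0.  The cost of a program is its number of
   instructions (inputs and constants are counted too). *)
Inductive instr (F : Type) : Type :=
  | ICst of F
  | IIn  of nat
  | IAdd of nat & nat
  | IMul of nat & nat
  | IOpp of nat
  | IInv of nat.         (* v_j ^-1  (0^-1 = 0 by convention) *)

Record slp (F : Type) : Type := SLP {
  instrs : seq (instr F);
  outs   : seq nat
}.

Definition cost (F : Type) (P : slp F) : nat := size (instrs P).

Section Run.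
Variable F : fieldType.
Local Open Scope ring_scope.

Definition step (inp : seq F) (vals : seq F) (ins : instr F) : seq F :=
  rcons vals
    (match ins with
     | ICst c => c
     | IIn i => nth 0 inp i
     | IAdd j k => nth 0 vals j + nth 0 vals k
     | IMul j k => nth 0 vals j * nth 0 vals k
     | IOpp j => - nth 0 vals j
     | IInv j => (nth 0 vals j)^-1
     end).

Definition run (P : slp F) (inp : seq F) : seq F :=
  foldl (step inp) [::] (instrs P).

(* row-major flattening: entry (i,j) has index i*m + j *)
Definition mx_input (l m : nat) (y : 'M[F]_(l, m)) : seq F :=
  flatten [seq [seq y i j | j <- enum 'I_m] | i <- enum 'I_l].

Definition decode (l m : nat) (P : slp F) (y : 'M[F]_(l, m)) : 'M[F]_(l, m) :=
  \matrix_(i < l, j < m) nth 0 (run P (mx_input y)) (nth 0%N (outs P) (i * m + j)).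
End Run.

Section Channel.
Variable F : finFieldType.
Local Open Scope R_scope.

Definition err_count (l m r : nat) (C : {set 'M[F]_(l, m)}) (P : slp F) : nat :=
  (\sum_(x in C) \sum_(z : 'M[F]_(l, m) | \rank z == r)
      \sum_(i < l) (row i (decode P (x + z)%R) != row i x))%N.

Definition noise_count (l m r : nat) : nat :=
  #|[set z : 'M[F]_(l, m) | \rank z == r]|.

(* symbol error probability of code C with decoder P over SNC with noise rank r:
   codeword uniform in C, noise uniform among rank-r matrices, averaged over
   the l rows *)
Definition sym_err_prob (l m r : nat) (C : {set 'M[F]_(l, m)}) (P : slp F) : R :=
  INR (err_count r C P) / (INR #|C| * INR (noise_count l m r) * INR l).

Definition rate (l m : nat) (C : {set 'M[F]_(l, m)}) (N : nat) : R :=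
  (ln (INR #|C|) / ln (INR #|F|)) / (INR N * INR l).
End Channel.

Definition SNC_capacity (lam om : R) : R := Rplus (Rminus (Rminus 1 lam) om) (Rmult lam (pow om 2)).

(* Main.v *)
(** Error trapping.  Let [v = r + s] with [s] a constant depending only on the
    target error, and send matrices whose first [v] rows and first [v] columns
    vanish: the rate loss against capacity is [O(s / N)].  The [v x v] corner of
    the output shows only the noise [z].  As soon as the first [v] rows of [z]
    span its row space and the first [v] columns its column space, eliminating
    [z] with pivots taken in that corner brings [z] to zero and never touches
    the codeword.  With the convention [0^-1 = 0] a useless pivot is a no-op, so
    a branch-free sweep over all corner positions does the elimination, in about
    [v^2 * 3 l m = O(N^4)] operations.  If the columns fail, the row space of
    [z] contains a nonzero vector whose first [v] coordinates vanish; double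
    counting the pairs (vector, matrix) bounds this by a fraction [q^-s] of the
    rank [r] matrices, and rows are symmetric. *)
Require Import Defs.
From Stdlib Require Import Reals Lra.
From mathcomp Require Import all_boot all_order all_algebra all_field.
From mathcomp Require Import mxabelem zify.
Set Implicit Arguments. Unset Strict Implicit. Unset Printing Implicit Defensive.
Import GRing.Theory.

(** * Elimination by pivots *)

Section Pivot.
Variables (F : fieldType) (l m : nat).
Local Open Scope ring_scope.
Implicit Types (M x z : 'M[F]_(l, m)) (p : 'I_l * 'I_m) (ps : seq ('I_l * 'I_m)).

(** A Schur complement step: a nonzero entry at [p] clears its whole row and column. *)
Definition pivot M p : 'M[F]_(l, m) :=
  M - (M p.1 p.2)^-1 *: (col p.2 M *m row p.1 M).

Lemma pivotE M p i j :
  pivot M p i j = M i j - (M p.1 p.2)^-1 * (M i p.2 * M p.1 j).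
Proof. by rewrite !mxE big_ord1 !mxE. Qed.

(* A pivot multiplies [M] by some [1 - M G] on the left and by [1 - G M] on the
   right, so its fixing matrices on both sides survive. *)
Lemma mulmx_pivot_fix (T : 'M_l) M ps :
  T *m M = M -> T *m foldl pivot M ps = foldl pivot M ps.
Proof.
elim: ps M => [|p ps IH] M //= TM; apply: IH.
by rewrite /pivot mulmxBr -scalemxAr colE !mulmxA TM.
Qed.

Lemma pivot_mulmx_fix (S : 'M_m) M ps :
  M *m S = M -> foldl pivot M ps *m S = foldl pivot M ps.
Proof.
elim: ps M => [|p ps IH] M //= MS; apply: IH.
by rewrite /pivot mulmxBl -scalemxAl rowE -!mulmxA MS.
Qed.

(** A pivot computes its correction from row [p.1] and column [p.2] alone; [x] vanishes there, so
    [x + z] and [z] receive the same correction. *)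
Lemma foldl_pivotDl x z ps :
  {in ps, forall p, row p.1 x = 0 /\ col p.2 x = 0} ->
  foldl pivot (x + z) ps = x + foldl pivot z ps.
Proof.
elim: ps z => [|p ps IH] z //= x0.
have [rx cx] := x0 p (mem_head _ _).
have -> : pivot (x + z) p = x + pivot z p.
  have xp : x p.1 p.2 = 0 by move/rowP/(_ p.2): (rx); rewrite !mxE.
  by rewrite /pivot mxE xp add0r [col _ _]linearD [row _ _]linearD /= rx cx !add0r addrA.
by apply: IH => p1 p1ps; apply: x0; rewrite inE p1ps orbT.
Qed.

Lemma pivot0_row M i j k : M i j = 0 -> pivot M (i, k) i j = 0.
Proof. by move=> Mij; rewrite pivotE Mij !mulr0 subr0. Qed.

Lemma pivot0_block M i p (t : seq 'I_m) :
  p.2 \in t -> {in t, forall j, M i j = 0} -> {in t, forall j, pivot M p i j = 0}.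
Proof. by move=> pt M0 j jt; rewrite pivotE !M0 // mul0r mulr0 subr0. Qed.

Lemma pivot0_self M p : pivot M p p.1 p.2 = 0.
Proof.
rewrite pivotE; have [->|Mp] := eqVneq (M p.1 p.2) 0; first by rewrite !mulr0 subr0.
by rewrite mulrA mulVf // mul1r subrr.
Qed.

(** Each pivot zeroes its own entry. At a zero of the pivot row the correction is a multiple of that
    zero, so later pivots in row [i] keep it. *)
Lemma sweep_row M i (t : seq 'I_m) :
  {in t, forall j, foldl pivot M [seq (i, j) | j <- t] i j = 0}.
Proof.
have keep s M' j : M' i j = 0 -> foldl pivot M' [seq (i, k) | k <- s] i j = 0.
  by elim: s M' => //= k s IH M' M0; apply: IH; apply: pivot0_row.
elim: t M => [|k t IH] M j //=; rewrite inE => /predU1P[->|/IH]; last exact.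
by apply: keep; rewrite (pivot0_self M (i, k)).
Qed.

Lemma sweep_block M (s : seq 'I_l) (t : seq 'I_m) :
  {in s & t, forall i j, foldl pivot M [seq (i, j) | i <- s, j <- t] i j = 0}.
Proof.
(* Once row [i] vanishes on [t], a pivot in a column of [t] has the factor [M' i p.2 = 0] and leaves
   that row unchanged: finished rows stay clear. *)
have keep ps M' i : {in ps, forall p, p.2 \in t} -> {in t, forall j, M' i j = 0} ->
    {in t, forall j, foldl pivot M' ps i j = 0}.
  elim: ps M' => //= p ps IH M' pst M0; apply: IH.
    by move=> p' p'ps; apply: pst; rewrite inE p'ps orbT.
  by apply: pivot0_block => //; apply: pst; rewrite mem_head.
elim: s M => [|k s IH] M i j //=; rewrite inE foldl_cat => /predU1P[->|si] jt; last exact: IH.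
apply: keep jt; last exact: sweep_row.
by move=> p /allpairsP[q [_ ? ->]].
Qed.

End Pivot.

(** [submx] compares row spaces, hence the transposes: the first [v] columns of [z] span its column
    space. *)
Definition col_trapped (F : fieldType) l m v (z : 'M[F]_(l, m)) : bool :=
  (z^T <= (z *m (pid_mx v : 'M_m))^T)%MS%R.

(** * Recovering the codeword from trapped noise *)

Section Decoding.
Variables (F : fieldType) (l m v : nat).
Local Open Scope ring_scope.

Definition corner_positions : seq ('I_l * 'I_m) :=
  [seq (i, j) | i <- [seq i : 'I_l <- enum 'I_l | (i < v)%N],
                j <- [seq j : 'I_m <- enum 'I_m | (j < v)%N]].

Lemma size_corner_positions : (size corner_positions <= l * m)%N.
Proof.
by rewrite size_allpairs !size_filter leq_mul // (leq_trans (count_size _ _)) ?size_enum_ord.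
Qed.

Lemma mul_pid_mxE n (M : 'M[F]_(l, n)) i j :
  ((pid_mx v : 'M_l) *m M) i j = if (i < v)%N then M i j else 0.
Proof.
rewrite mxE (bigD1 i) //= big1 => [|k ki]; rewrite mxE ?eqxx /=.
  by case: ifP; rewrite ?mul1r ?mul0r addr0.
by rewrite [_ == _ :> nat]eq_sym -[_ == _]/(k == i) (negPf ki) mul0r.
Qed.

Lemma mul_mx_pidE n (M : 'M[F]_(n, m)) i j :
  (M *m (pid_mx v : 'M_m)) i j = if (j < v)%N then M i j else 0.
Proof.
rewrite mxE (bigD1 j) //= big1 => [|k ki]; rewrite mxE ?eqxx /=.
  by case: ifP; rewrite ?mulr1 ?mulr0 addr0.
by rewrite -[_ == _]/(k == j) (negPf ki) mulr0.
Qed.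

(** With [P = pid_mx v], trapping gives [z = T P z] and [z = z P S^T]. Both identities survive the
    sweep, so its result [w] equals [T (P w P) S^T], where the corner [P w P] has been cleared. *)
Lemma sweep_trapped z : col_trapped v z^T -> col_trapped v z ->
  foldl (@pivot F l m) z corner_positions = 0.
Proof.
rewrite /col_trapped trmxK trmx_mul trmxK tr_pid_mx => /submxP[T zT].
case/submxP=> S /(congr1 trmx); rewrite trmx_mul !trmxK => zS.
set w := foldl _ _ _.
have wT : T *m pid_mx v *m w = w by apply: mulmx_pivot_fix; rewrite -mulmxA -zT.
have wS : w *m (pid_mx v *m S^T) = w by apply: pivot_mulmx_fix; rewrite mulmxA -zS.
suff w0 : (pid_mx v : 'M_l) *m w *m (pid_mx v : 'M_m) = 0.
  rewrite -wT -wS [w *m _]mulmxA -!mulmxA [w *m _]mulmxA.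
  by rewrite 2![pid_mx v *m _]mulmxA w0 mul0mx mulmx0.
apply/matrixP=> i j; rewrite mul_mx_pidE mul_pid_mxE mxE.
case: ifP => // jv; case: ifP => // iv.
by apply: sweep_block; rewrite mem_filter ?iv ?jv mem_enum.
Qed.

Lemma decode_trapped (x z : 'M[F]_(l, m)) :
  (forall (i : 'I_l) (j : 'I_m), (i < v)%N || (j < v)%N -> x i j = 0) ->
  col_trapped v z^T -> col_trapped v z ->
  foldl (@pivot F l m) (x + z) corner_positions = x.
Proof.
move=> x0 zr zc; rewrite foldl_pivotDl ?sweep_trapped ?addr0 //.
move=> p /allpairsP[[i j] /= [+ + ->]]; rewrite !mem_filter /= => /andP[iv _] /andP[jv _].
by split; [apply/rowP|apply/colP] => k; rewrite !mxE x0 // ?iv ?jv ?orbT.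
Qed.

End Decoding.

(** * Counting untrapped noise *)

Section Counting.
Variable F : finFieldType.
Local Notation q := #|F|.

Definition over_count (m n r : nat) (u : 'rV[F]_n) :=
  #|[set z : 'M[F]_(m, n) | (\rank z == r) && (u <= z)%MS]|.

Lemma over_countM (m n r : nat) (u : 'rV[F]_n) (g : 'M[F]_n) :
  g \in unitmx -> over_count m r (u *m g)%R = over_count m r u.
Proof.
move=> ug; have fg : row_free g by rewrite row_free_unit.
rewrite /over_count -!sum1_card (reindex_inj (can_inj (mulmxK ug))).
by apply: eq_bigl => z; rewrite !inE mxrankMfree // submxMfree.
Qed.

(** Invertible matrices act transitively on nonzero row vectors. *)
Lemma over_count_nz (m n r : nat) (u : 'rV[F]_n) : u != 0%R ->
  over_count m r u = over_count m r (pid_mx 1 : 'rV[F]_n).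
Proof.
move=> u0.
have ru : \rank u = 1.
  by apply/eqP; rewrite eqn_leq rank_leq_row lt0n mxrank_eq0.
(* The left base change of a row vector is a 1 x 1 matrix, a nonzero scalar that can be absorbed
   into [row_ebase u]. *)
have cE := mx11_scalar (col_ebase u).
have := mulmx_ebase u; rewrite {}ru {1}cE -mulmxA mul_scalar_mx scalemxAr => <-.
rewrite over_countM // unitmxZ ?row_ebase_unit //.
by have := col_ebase_unit u; rewrite unitmxE {1}cE det_scalar1.
Qed.

Lemma card_nz_sub m n (A : 'M[F]_(m, n)) :
  #|[set u : 'rV[F]_n | (u != 0%R) && (u <= A)%MS]| = (q ^ \rank A).-1.
Proof.
rewrite -card_rowg (cardsD1 0%R (rowg A)) mem_rowg sub0mx /=.
by apply: eq_card => u; rewrite !inE.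
Qed.

(** Double counting of pairs of a rank [r] matrix and a nonzero vector of its row space. *)
Lemma over_count_total (m n r : nat) :
  (q ^ n).-1 * over_count m r (pid_mx 1 : 'rV[F]_n) = (q ^ r).-1 * noise_count F m n r.
Proof.
transitivity (\sum_(u : 'rV[F]_n | u != 0%R) over_count m r u).
  rewrite (eq_bigr _ (fun u => @over_count_nz m n r u)) sum_nat_const; congr (_ * _).
  have := card_nz_sub (1%:M : 'M[F]_n)%R; rewrite mxrank1 => <-.
  by apply: eq_card => u; rewrite !inE submx1 andbT.
under eq_bigr do rewrite /over_count -sum1_card big_mkcond /=.
rewrite exchange_big /= /noise_count mulnC -sum_nat_const [RHS]big_mkcond /=.
apply: eq_bigr => z _; rewrite inE; case: eqP => [<-|/eqP zr]; last first.
  by rewrite big1 // => u _; rewrite inE (negPf zr).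
rewrite -card_nz_sub -sum1_card -big_mkcondr /=.
by apply: eq_bigl => u; rewrite !inE eqxx.
Qed.

(** The cokernel yields the combinations of rows of [z] that vanish on the first [v] columns; if all
    of them were zero, those columns would span. *)
Lemma untrapped_witness m n v (z : 'M[F]_(m, n)) :
  ~~ col_trapped v z ->
  exists u : 'rV[F]_n,
    [/\ u != 0, (u <= kermx (pid_mx v : 'M[F]_n))%MS & (u <= z)%MS]%R.
Proof.
rewrite /col_trapped submxE => Kz0; set K := cokermx _ in Kz0.
have KQ : (K^T *m (z *m (pid_mx v : 'M_n)) = 0)%R.
  by apply: trmx_inj; rewrite trmx_mul trmxK mulmx_coker trmx0.
have /rowV0Pn[u /submxP[w uE] u0] : (K^T *m z != 0)%R.
  by rewrite -(inj_eq trmx_inj) trmx_mul trmxK trmx0.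
exists u; split=> //; last by rewrite uE mulmxA submxMl.
by apply/sub_kermxP; rewrite uE -!mulmxA KQ mulmx0.
Qed.

(** Union bound over the possible witnesses, the [q^(n-r-s) - 1] nonzero vectors with zero first
    [r + s] coordinates; each lies in the row space of a fraction [(q^r - 1) / (q^n - 1)] of the
    matrices. *)
Lemma card_untrapped_cols (m n r s : nat) : r + s <= n ->
  q ^ s * #|[set z : 'M[F]_(m, n) | (\rank z == r) &&
              ~~ col_trapped (r + s) z]|
    <= noise_count F m n r.
Proof.
move=> rsn; set B := [set z | _].
have q_gt0 : 0 < q by apply/card_gt0P; exists 0%R.
set o := over_count m r (pid_mx 1 : 'rV[F]_n).
have leB : #|B| <= (q ^ (n - (r + s))).-1 * o.
  set U := [set u : 'rV[F]_n | (u != 0%R) && (u <= kermx (pid_mx (r + s) : 'M[F]_n))%MS].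
  have <- : \sum_(u in U) over_count m r u = (q ^ (n - (r + s))).-1 * o.
    rewrite (eq_bigr (fun=> o)) => [|u]; last by rewrite inE => /andP[/over_count_nz->].
    by rewrite sum_nat_const card_nz_sub mxrank_ker rank_pid_mx.
  have -> : #|B| = \sum_(z in B) 1 by rewrite sum1_card.
  under [leqRHS]eq_bigr do rewrite /over_count -sum1_card big_mkcond /=.
  rewrite exchange_big /= [leqLHS]big_mkcond /=; apply: leq_sum => z _.
  case: ifP => //; rewrite inE => /andP[rz /untrapped_witness[u [u0 uk uz]]].
  by rewrite (bigD1 u) ?inE ?u0 //= rz uz.
have := over_count_total m n r; rewrite -/o => oE.
(* Cancelling [q^n - 1] requires [n > 0]; for [n = 0] there is no witness at all. *)
have [n0|n_gt0] := posnP n.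
  move: leB; rewrite (_ : n - (r + s) = 0) ?expn0; last lia.
  by rewrite mul0n leqn0 => /eqP->; rewrite muln0.
have qn_gt0 : 0 < (q ^ n).-1.
  by rewrite -subn1 subn_gt0 -{1}(expn0 q) ltn_exp2l // finNzRing_gt1.
rewrite -(leq_pmul2l qn_gt0).
apply: (@leq_trans (q ^ s * (q ^ (n - (r + s))).-1 * ((q ^ r).-1 * noise_count F m n r))).
  by rewrite -oE mulnCA -mulnA leq_mul2l [leqRHS]mulnCA leq_mul2l leB !orbT.
rewrite mulnA leq_mul2r; apply/orP; right.
have -> : q ^ n = q ^ r * q ^ s * q ^ (n - (r + s)) by rewrite -!expnD subnKC.
have := (expn_gt0 q r, expn_gt0 q s, expn_gt0 q (n - (r + s))); rewrite q_gt0 /=.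
(* With the powers written [a+1], [b+1], [c+1], the claim is [(b+1) c a <= (a+1)(b+1)(c+1) - 1]. *)
case: (q ^ r) (q ^ s) (q ^ (n - _)) => [|a] [|b] [|c] [[]] //= _ _ _.
nia.
Qed.

End Counting.

(** * The decoder as a straight-line program *)

Section Program.
Variables (F : fieldType) (l m : nat).
Local Open Scope ring_scope.
Local Notation lm := (l * m)%N.
Implicit Types (f g h : nat -> F) (p : 'I_l * 'I_m) (ps : seq ('I_l * 'I_m)).

Definition instr_val (inp vals : seq F) (ins : instr F) : F := last 0 (step inp vals ins).

(** The arbitrary suffix [w] stands for what the same pass has already written: its instructions may
    read only [vals] and the input. *)
Lemma foldl_step_mkseq (inp vals : seq F) (ins : nat -> instr F) h k :
  (forall i w, (i < k)%N -> instr_val inp (vals ++ w) (ins i) = h i) ->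
  foldl (step inp) vals (mkseq ins k) = vals ++ mkseq h k.
Proof.
elim: k => [|k IH] insE; first by rewrite /= cats0.
rewrite !mkseqS foldl_rcons IH => [|i w ik]; last by rewrite insE // leqW.
by rewrite -rcons_cat -(insE k (mkseq h k)) // /instr_val /step last_rcons.
Qed.

Lemma nth_cat_mkseq (pre w : seq F) f k b i : size pre = b -> (i < k)%N ->
  nth 0 ((pre ++ mkseq f k) ++ w) (b + i) = f i.
Proof.
move=> <- ik; rewrite !nth_cat size_cat size_mkseq ltn_add2l ik.
by rewrite ltnNge leq_addr /= addKn nth_mkseq.
Qed.

Definition flat_index (i j : nat) : nat := (i * m + j)%N.

Lemma flat_index_lt (i : 'I_l) (j : 'I_m) : (flat_index i j < lm)%N.
Proof. by rewrite /flat_index; have := ltn_ord i; have := ltn_ord j; nia. Qed.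

(* [b] is the address of the first entry of the current matrix; the three
   passes produce the products [M i j0 * M i0 j], their multiples by
   [- (M i0 j0)^-1], and the updated matrix, at address [b + block_len]. *)
Definition pivot_block (b : nat) p : seq (instr F) :=
  [:: Defs.IInv F (b + flat_index p.1 p.2); Defs.IOpp F (b + lm)]
  ++ mkseq (fun k => Defs.IMul F (b + flat_index (k %/ m) p.2) (b + flat_index p.1 (k %% m))) lm
  ++ mkseq (fun k => Defs.IMul F (b + lm).+1 ((b + lm).+2 + k)) lm
  ++ mkseq (fun k => Defs.IAdd F (b + k) ((b + lm).+2 + lm + k)) lm.

(** Both the instruction count of a block and the distance between successive matrices: old matrix,
    two scalars, two arrays of products. *)
Definition block_len : nat := (3 * lm).+2.

Definition flat_pivot f p (k : nat) : F :=
  f k - (f (flat_index p.1 p.2))^-1 *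
    (f (flat_index (k %/ m) p.2) * f (flat_index p.1 (k %% m))).

Lemma run_pivot_block (inp pre : seq F) f p :
  exists2 pre', size pre' = (size pre + block_len)%N &
    foldl (step inp) (pre ++ mkseq f lm) (pivot_block (size pre) p) =
    pre' ++ mkseq (flat_pivot f p) lm.
Proof.
set b := size pre; set c := (f (flat_index p.1 p.2))^-1.
have idx_lt k : (k < lm)%N ->
    (flat_index (k %/ m) p.2 < lm)%N * (flat_index p.1 (k %% m) < lm)%N.
  move=> klm; have m_gt0 : (0 < m)%N by apply: leq_ltn_trans (ltn_ord p.2).
  have kl : (k %/ m < l)%N by rewrite ltn_divLR.
  by split; [apply: (flat_index_lt (Ordinal kl) p.2)
            |apply: (flat_index_lt p.1 (Ordinal (ltn_pmod k m_gt0)))].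
have nth0 w k : (k < lm)%N -> nth 0 ((pre ++ mkseq f lm) ++ w) (b + k) = f k.
  by move=> klm; apply: nth_cat_mkseq.
have size0 : size (pre ++ mkseq f lm) = (b + lm)%N by rewrite size_cat size_mkseq.
pose pre1 := (pre ++ mkseq f lm) ++ [:: c; - c].
have size1 : size pre1 = (b + lm).+2 by rewrite size_cat size0 addn2.
pose h1 k := f (flat_index (k %/ m) p.2) * f (flat_index p.1 (k %% m)).
pose pre2 := pre1 ++ mkseq h1 lm.
have size2 : size pre2 = ((b + lm).+2 + lm)%N by rewrite size_cat size1 size_mkseq.
pose h2 k := - c * h1 k.
exists (pre2 ++ mkseq h2 lm).
  by rewrite size_cat size2 size_mkseq /block_len; lia.
rewrite /pivot_block foldl_cat.
have -> : foldl (step inp) (pre ++ mkseq f lm)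
    [:: Defs.IInv F (b + flat_index p.1 p.2); Defs.IOpp F (b + lm)] = pre1.
  rewrite /= /step /= -!cats1.
  rewrite -[X in nth 0 X (b + flat_index _ _)]cats0 nth0 ?flat_index_lt // -/c.
  by rewrite nth_cat size0 ltnn subnn /= -catA.
rewrite foldl_cat (@foldl_step_mkseq _ _ _ h1) => [|k w klm]; last first.
  have [k1 k2] := idx_lt _ klm.
  by rewrite /instr_val /step last_rcons /pre1 -catA !nth0.
rewrite foldl_cat (@foldl_step_mkseq _ pre2 _ h2) => [|k w klm]; last first.
  rewrite /instr_val /step last_rcons /= (nth_cat_mkseq _ _ size1) //.
  by rewrite -catA /pre1 -catA nth_cat size0 ltnNge leqnSn subSnn.
apply: foldl_step_mkseq => k w klm.
rewrite /instr_val /step last_rcons (nth_cat_mkseq _ _ size2) //.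
by rewrite /pre2 /pre1 -!catA catA nth0 // /flat_pivot -/c /h2 mulNr.
Qed.

Fixpoint sweep_instrs (b : nat) ps : seq (instr F) :=
  if ps is p :: ps' then pivot_block b p ++ sweep_instrs (b + block_len) ps' else [::].

Lemma run_sweep (inp pre : seq F) f ps :
  exists2 pre', size pre' = (size pre + size ps * block_len)%N &
    foldl (step inp) (pre ++ mkseq f lm) (sweep_instrs (size pre) ps) =
    pre' ++ mkseq (foldl flat_pivot f ps) lm.
Proof.
elim: ps pre f => [|p ps IH] pre f; first by exists pre; rewrite ?addn0.
have [pre1 sz1 E1] := run_pivot_block inp pre f p.
have [pre2 sz2 E2] := IH pre1 (flat_pivot f p).
by exists pre2; [rewrite sz2 sz1 mulSn addnA | rewrite -E2 sz1 -E1 -foldl_cat].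
Qed.

Lemma size_sweep_instrs b ps : size (sweep_instrs b ps) = (size ps * block_len)%N.
Proof.
elim: ps b => [|p ps IH] b //=.
by rewrite !size_cat /= !size_mkseq IH mulSn /block_len; lia.
Qed.

(** Loading the input puts the first matrix at address 0; each pivot moves the current one by
    [block_len]. *)
Definition sweep_program ps : slp F :=
  SLP (mkseq (Defs.IIn F) lm ++ sweep_instrs 0 ps) (mkseq (addn (size ps * block_len)) lm).

Lemma cost_sweep_program ps : cost (sweep_program ps) = (lm + size ps * block_len)%N.
Proof. by rewrite /cost size_cat size_mkseq size_sweep_instrs. Qed.

Lemma nth_mx_input (y : 'M[F]_(l, m)) (i : 'I_l) (j : 'I_m) :
  nth 0 (mx_input y) (flat_index i j) = y i j.
Proof.
pose s := [seq [seq y i j | j <- enum 'I_m] | i <- enum 'I_l].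
have szs : shape s = nseq l m.
  rewrite /shape /s -map_comp (eq_map (g := fun=> m)) => [|i0] /=; last first.
    by rewrite size_map size_enum_ord.
  by rewrite -[in RHS](size_enum_ord l); elim: (enum _) => //= ? ? ->.
rewrite /mx_input -/s nth_flatten szs.
have -> : flat_index i j = flatten_index (nseq l m) i j.
  by rewrite /flat_index /flatten_index take_nseq ?sumn_nseq 1?mulnC // ltnW.
rewrite flatten_indexKl ?flatten_indexKr ?nth_nseq ?ltn_ord //.
by rewrite (nth_map i) ?size_enum_ord // nth_ord_enum (nth_map j) ?size_enum_ord // nth_ord_enum.
Qed.

Lemma flat_pivotE f (M : 'M[F]_(l, m)) p :
  (forall (i : 'I_l) (j : 'I_m), f (flat_index i j) = M i j) ->
  forall (i : 'I_l) (j : 'I_m), flat_pivot f p (flat_index i j) = pivot M p i j.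
Proof.
move=> fM i j; have m_gt0 : (0 < m)%N by apply: leq_ltn_trans (ltn_ord j).
rewrite pivotE /flat_pivot {2 3}/flat_index divnMDl // divn_small // addn0.
by rewrite modnMDl modn_small // !fM.
Qed.

Lemma decode_sweep_program ps (y : 'M[F]_(l, m)) :
  decode (sweep_program ps) y = foldl (@pivot F l m) y ps.
Proof.
have flatE f : (forall (i : 'I_l) (j : 'I_m), f (flat_index i j) = y i j) ->
    forall (i : 'I_l) (j : 'I_m),
    foldl flat_pivot f ps (flat_index i j) = foldl (@pivot F l m) y ps i j.
  elim: ps y f => [|p ps IH] y' f fy //= i j.
  by apply: IH => i' j'; apply: flat_pivotE.
apply/matrixP=> i j; rewrite mxE -[(i * m + j)%N]/(flat_index i j) nth_mkseq ?flat_index_lt //.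
rewrite /run /= foldl_cat (@foldl_step_mkseq _ _ _ (nth 0 (mx_input y))) => [|k w _]; last first.
  by rewrite /instr_val /step last_rcons.
have [pre sz ->] := run_sweep (mx_input y) [::] (nth 0 (mx_input y)) ps.
rewrite -[_ ++ _]cats0 (nth_cat_mkseq _ _ sz) ?flat_index_lt // flatE //.
exact: nth_mx_input.
Qed.

End Program.

(** * The code *)

Section TrappingCode.
Variable F : finFieldType.
Local Notation q := #|F|.

Lemma noise_count_tr m n r : noise_count F m n r = noise_count F n m r.
Proof.
rewrite /noise_count -!sum1_card (reindex (@trmx F n m)) /=; last first.
  by exists trmx => z _; rewrite trmxK.
by apply: eq_bigl => z; rewrite !inE mxrank_tr.
Qed.

Lemma noise_count_gt0 m n r : r <= m -> r <= n -> 0 < noise_count F m n r.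
Proof.
by move=> rm rn; apply/card_gt0P; exists (pid_mx r); rewrite inE rank_pid_mx.
Qed.

(** Failure of the rows of [z] is failure of the columns of [z^T]; the factor 2 is the union
    bound. *)
Lemma card_untrapped (m n r s : nat) : r + s <= m -> r + s <= n ->
  q ^ s * #|[set z : 'M[F]_(m, n) | (\rank z == r) &&
              ~~ (col_trapped (r + s) z^T%R && col_trapped (r + s) z)]|
    <= 2 * noise_count F m n r.
Proof.
move=> rsm rsn; set B := [set z | _].
pose Bc m n := [set z : 'M[F]_(m, n) | (\rank z == r) && ~~ col_trapped (r + s) z].
have leB : #|B| <= #|Bc n m| + #|Bc m n|.
  rewrite -(card_imset (Bc n m) (@trmx_inj F n m)).
  apply: leq_trans (leq_card_setU _ _).1; apply/subset_leq_card/subsetP=> z.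
  rewrite !inE => /andP[rz].
  rewrite negb_and rz /= => /orP[zr|->]; last by rewrite orbT.
  by rewrite -[z]trmxK imset_f // inE mxrank_tr rz.
rewrite (leq_trans (leq_mul (leqnn _) leB)) // mulnDr mul2n -addnn.
by rewrite leq_add // ?card_untrapped_cols // noise_count_tr card_untrapped_cols.
Qed.

Definition corner_code v l m : {set 'M[F]_(v + l, v + m)} :=
  [set block_mx 0%R 0%R 0%R d | d : 'M[F]_(l, m)].

Lemma card_corner_code v l m : #|corner_code v l m| = q ^ (l * m).
Proof.
rewrite card_imset => [|d d' /eq_block_mx[] //].
by rewrite card_mx.
Qed.

Lemma corner_code0 v l m x (i : 'I_(v + l)) (j : 'I_(v + m)) :
  x \in corner_code v l m -> (i < v) || (j < v) -> x i j = 0%R.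
Proof.
case/imsetP=> d _ ->.
case: (split_ordP i) => i' ->; case: (split_ordP j) => j' ->;
  by rewrite ?block_mxEul ?block_mxEur ?block_mxEdl ?mxE //= ltnNge leq_addr ltnNge leq_addr.
Qed.

(** Trapped noise causes no error; for untrapped noise all [v + l] rows are charged. *)
Lemma err_count_corner_code (l m r s : nat) (v := r + s) :
  q ^ s * err_count r (corner_code v l m) (sweep_program F (corner_positions (v + l) (v + m) v))
    <= 2 * (#|corner_code v l m| * noise_count F (v + l) (v + m) r * (v + l)).
Proof.
set P := sweep_program F _; set C := corner_code v l m.
set B := [set z : 'M[F]_(v + l, v + m) | (\rank z == r) &&
              ~~ (col_trapped (r + s) z^T%R && col_trapped (r + s) z)].
have leE : err_count r C P <= #|C| * (#|B| * (v + l)).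
  rewrite -sum_nat_const; apply: leq_sum => x xC.
  rewrite -sum_nat_const [leqLHS]big_mkcond [leqRHS]big_mkcond; apply: leq_sum => z _ /=.
  rewrite inE; case: eqP => //= rz; case: ifPn => [_|/negPn/andP[zr zc]].
    apply: (@leq_trans (\sum_(i < v + l) 1)); last by rewrite sum1_card card_ord.
    by apply: leq_sum => i _; case: (_ != _).
  rewrite big1 // => i _; rewrite decode_sweep_program decode_trapped ?eqxx //.
  by move=> i' j'; apply: corner_code0.
rewrite (leq_trans (leq_mul (leqnn _) leE)) //.
have := @card_untrapped (v + l) (v + m) r s (leq_addr _ _) (leq_addr _ _).
rewrite -/B => leB.
by rewrite [leqLHS]mulnCA -[X in 2 * X]mulnA [leqRHS]mulnCA leq_mul2l !mulnA leq_mul2r leB !orbT.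
Qed.

End TrappingCode.

(** * Real bounds on cost, rate and error probability *)

Section RealBounds.
Local Open Scope R_scope.

Lemma INR_leq n k : (n <= k)%N -> INR n <= INR k.
Proof. by move/leP/le_INR. Qed.

Lemma INR_addn n k : INR (n + k)%N = INR n + INR k.
Proof. by rewrite -plusE plus_INR. Qed.

Lemma INR_muln n k : INR (n * k)%N = INR n * INR k.
Proof. by rewrite -multE mult_INR. Qed.

Lemma INR_subn n k : (k <= n)%N -> INR (n - k)%N = INR n - INR k.
Proof. by move/leP => kn; rewrite -minusE minus_INR. Qed.

Lemma INR_expn n k : INR (n ^ k)%N = INR n ^ k.
Proof. by elim: k => [|k IH]; rewrite ?expn0 // expnS INR_muln IH. Qed.

Lemma leq_of_INR n k : INR n <= INR k -> (n <= k)%N.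
Proof. by move/INR_le/leP. Qed.

Lemma cost_corner_sweep (F : fieldType) l m v N : (0 < N)%N -> (l <= N)%N -> (m <= N)%N ->
  INR (cost (sweep_program F (corner_positions l m v))) <= 6 * INR N ^ 4.
Proof.
move=> N_gt0 lN mN; rewrite cost_sweep_program.
have lmN : (l * m <= N * N)%N by rewrite leq_mul.
have N2 : (0 < N * N)%N by rewrite muln_gt0 N_gt0.
have -> : 6 * INR N ^ 4 = INR (6 * (N * N * (N * N)))%N.
  by rewrite !INR_muln [INR 6]/=; ring.
apply: INR_leq; have := size_corner_positions l m v; rewrite /block_len => szN.
(* With [a = l m <= b = N^2] and [b >= 1], the cost is at most [3 a + 3 a^2 <= 6 b^2]. *)
apply: (@leq_trans (l * m + l * m * (3 * (l * m)).+2)).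
  by rewrite leq_add2l leq_mul2r szN orbT.
by move: (l * m)%N (N * N)%N lmN N2 => a b; nia.
Qed.

Variable F : finFieldType.
Local Notation q := #|F|.

Let q_gt1 : (1 < q)%N. Proof. exact: finNzRing_gt1. Qed.

Lemma rate_pow l m (C : {set 'M[F]_(l, m)}) k N :
  #|C| = (q ^ k)%N -> rate C N = INR k / (INR N * INR l).
Proof.
move=> cC; have q1 : 1 < INR q by apply: (lt_INR 1); apply/ltP.
have lnq : 0 < ln (INR q) by rewrite -ln_1; apply: ln_increasing; lra.
by rewrite /rate cC INR_expn ln_pow; [congr (_ / _); field|]; lra.
Qed.

(** The error is at most [2 / q^s], and the crude bound [s < q^s] already brings this below [pe]. *)
Lemma sym_err_prob_corner_code (l m r s : nat) (pe : R) (v := (r + s)%N) :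
  (0 < v + l)%N -> 0 < pe -> 2 / pe < INR s ->
  sym_err_prob r (corner_code F v l m)
    (sweep_program F (corner_positions (v + l) (v + m) v)) < pe.
Proof.
move=> l_gt0 pe0 hs; have := @err_count_corner_code F l m r s; rewrite -/v.
rewrite /sym_err_prob; set e := err_count _ _ _ => /INR_leq.
have C0 : (0 < #|corner_code F v l m|)%N.
  by rewrite card_corner_code expn_gt0 ltnW.
have n0 : (0 < noise_count F (v + l) (v + m) r)%N.
  by apply: noise_count_gt0; rewrite /v -addnA leq_addr.
have pos k : (0 < k)%N -> 0 < INR k by move/ltP/lt_0_INR.
have := Rmult_lt_0_compat _ _ (Rmult_lt_0_compat _ _ (pos _ C0) (pos _ n0)) (pos _ l_gt0).
rewrite 4!INR_muln; set d := (_ * _ * _) => d0 ed.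
have sq : INR s < INR (q ^ s)%N by apply: lt_INR; apply/ltP/ltn_expl.
have s0 : 0 < INR s by apply: Rlt_trans hs; apply: Rdiv_lt_0_compat; lra.
apply: (Rmult_lt_reg_r d) => //.
rewrite /Rdiv Rmult_assoc Rinv_l ?Rmult_1_r; last lra.
apply: (Rmult_lt_reg_l (INR (q ^ s)%N)); first lra.
apply: Rle_lt_trans ed _; rewrite [INR 2]/=.
rewrite -Rmult_assoc; apply: Rmult_lt_compat_r => //.
apply: (Rmult_lt_reg_r (/ pe)); first exact: Rinv_0_lt_compat.
by rewrite Rmult_assoc Rinv_r; lra.
Qed.

(** Serves nonpositive target rates: every output of the empty program defaults to 0, the only
    codeword. *)
Lemma trivial_code (l m r N : nat) (P := SLP [::] [::] : slp F) (C := [set 0%R : 'M[F]_(l, m)]) :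
  rate C N = 0 /\ sym_err_prob r C P = 0.
Proof.
rewrite /rate /sym_err_prob cards1 ln_1; split; first by rewrite /Rdiv !Rmult_0_l.
have -> : err_count r C P = 0%N; last by rewrite /Rdiv Rmult_0_l.
rewrite /err_count big_set1 big1 // => z _; rewrite big1 // => i _.
have -> : decode P (0 + z)%R = 0%R; last by rewrite eqxx.
by apply/matrixP=> i' j'; rewrite !mxE nth_nil.
Qed.

End RealBounds.

(** * Choice of parameters *)

Open Scope R_scope.

Theorem theorem1 (F : finFieldType) (lam om Rt : R) :
  0 < lam < 1 -> 0 < om < 1 ->
  (exists k : nat, (1 - lam) / lam = INR k * om) ->
  Rt < SNC_capacity lam om ->
  exists K : R, 0 < K /\
    forall pe : R, 0 < pe ->
    exists N0 : nat, forall N l m r : nat,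
      (N0 <= N)%N ->
      INR l = lam * INR N -> m = (N - l)%N -> INR r = om * INR l ->
      exists (C : {set 'M[F]_(l, m)}) (P : slp F),
        (0 < #|C|)%N /\
        Rt <= rate C N /\
        sym_err_prob r C P < pe /\
        INR (cost P) <= K * INR N ^ 4 * Rmax 1 (ln (ln (/ pe))).
Proof.
move=> lam01 om01 _ RtC; exists 6; split; first lra.
move=> pe pe0.
(* The cost bound is uniform in [pe], which enters only through [s] and [N0]. *)
have bound N c : c <= 6 * INR N ^ 4 -> c <= 6 * INR N ^ 4 * Rmax 1 (ln (ln (/ pe))).
  move/Rle_trans; apply; rewrite -[X in X <= _]Rmult_1_r.
  apply: Rmult_le_compat_l; last exact: Rmax_l.
  by have := pow_le (INR N) 4 (pos_INR N); lra.
have [Rt0|Rt0] := Rle_or_lt Rt 0.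
  exists 0%N => N l m r _ _ _ _.
  exists [set 0%R], (SLP [::] [::]); have [-> ->] := @trivial_code F l m r N.
  rewrite cards1; do 3!split => //.
  by apply: bound; rewrite /cost /=; have := pow_le (INR N) 4 (pos_INR N); lra.
have [s hs] := INR_unbounded (2 / pe).
(* The noise-free block has sides [l - r = a N] and [m - r = b N], each then shortened by [s]. *)
set a := lam * (1 - om); set b := 1 - lam - om * lam.
have CE : SNC_capacity lam om = (1 - om) * b.
  by rewrite /SNC_capacity /b; ring.
have a0 : 0 < a by apply: Rmult_lt_0_compat; lra.
(* Here [0 < Rt < (1 - om) * b] is used. *)
have b0 : 0 < b by nra.
(* The slack [d N^2] in the number of message symbols must absorb the loss, at most [s N]. *)
set d := (SNC_capacity lam om - Rt) * lam.
have d0 : 0 < d by apply: Rmult_lt_0_compat; lra.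
have [N0 hN0] := INR_unbounded (INR s / a + INR s / b + INR s / d).
(* The successor forces [N > 0]. *)
exists N0.+1 => N l m r NN0 lE mE rE.
have s0 := pos_INR s.
have large c : 0 < c -> INR s / c <= INR s / a + INR s / b + INR s / d -> INR s <= c * INR N.
  move=> c0 cle; have : INR N0 <= INR N by apply: INR_leq; apply: ltnW.
  move=> NN; have : INR s / c <= INR N by lra.
  move/(Rmult_le_compat_l c _ _ (Rlt_le _ _ c0)).
  by have -> : c * (INR s / c) = INR s by field; lra.
have ge0 c : 0 < c -> 0 <= INR s / c by move=> c0; apply: Rle_mult_inv_pos.
have [sa sb sd] : [/\ INR s <= a * INR N, INR s <= b * INR N & INR s <= d * INR N].
  by split; apply: large => //; have := ge0 _ a0; have := ge0 _ b0; have := ge0 _ d0; lra.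
have N_gt0 : (0 < N)%N by apply: leq_trans NN0.
have N0' : 0 < INR N by apply/lt_0_INR/ltP.
have lN : (l <= N)%N by apply: leq_of_INR; rewrite lE; nra.
have mE' : INR m = (1 - lam) * INR N by rewrite mE INR_subn // lE; ring.
have vl : (r + s <= l)%N by apply: leq_of_INR; rewrite INR_addn rE lE; move: sa; rewrite /a; lra.
have vm : (r + s <= m)%N by apply: leq_of_INR; rewrite INR_addn rE lE mE'; move: sb; rewrite /b; lra.
have mN : (m <= N)%N by rewrite mE leq_subr.
set v := (r + s)%N in vl vm.
have [l' l'E] : exists l', l = (v + l')%N by exists (l - v)%N; rewrite subnKC.
have [m' m'E] : exists m', m = (v + m')%N by exists (m - v)%N; rewrite subnKC.
have l'R : INR l' = INR l - INR r - INR s by rewrite l'E /v !INR_addn; ring.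
have m'R : INR m' = INR m - INR r - INR s by rewrite m'E /v !INR_addn; ring.
clear vl vm mE; subst l m.
exists (corner_code F v l' m'), (sweep_program F (corner_positions (v + l') (v + m') v)).
have l_gt0 : (0 < v + l')%N.
  by apply/ltP/INR_lt; rewrite lE; apply: Rmult_lt_0_compat; lra.
split; first by rewrite card_corner_code expn_gt0 (ltnW (finNzRing_gt1 F)).
split; last split; [|exact: sym_err_prob_corner_code|exact/bound/cost_corner_sweep].
rewrite (rate_pow _ (card_corner_code F v l' m')) INR_muln l'R m'R.
have Nl0 : 0 < INR N * INR (v + l') by rewrite lE; apply: Rmult_lt_0_compat => //; nra.
apply: (Rmult_le_reg_r (INR N * INR (v + l'))) => //.
rewrite /Rdiv Rmult_assoc Rinv_l ?Rmult_1_r; last lra.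
rewrite mE' rE lE.
(* Since [a + b = 1 - 2 * om * lam], this expands [(a N - s)(b N - s)], with
   [a b = lam * SNC_capacity lam om]. *)
have -> : (lam * INR N - om * (lam * INR N) - INR s) *
    ((1 - lam) * INR N - om * (lam * INR N) - INR s)
  = SNC_capacity lam om * INR N * (lam * INR N)
    - INR s * (1 - 2 * om * lam) * INR N + INR s * INR s.
  by rewrite CE /b; ring.
have : INR s * INR N <= d * INR N * INR N by apply: Rmult_le_compat_r; lra.
have : 0 <= INR s * (om * lam) * INR N by apply: Rmult_le_pos; [apply: Rmult_le_pos|]; nra.
by rewrite /d; nra.
Qed.
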